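(* Let $d\ge 1$ be an integer, let $\alpha>0$ and $\delta>0$ be real numbers, let $N_1,\dots,N_d\ge 2$ be integers, and let $\Omega_{\mathrm D}=\{\vec n=(n_1,\dots,n_d)\in\mathbb{Z}^d : 0\le n_k\le N_k\ (k=1,\dots,d)\}$. Then there exists $\varepsilon>0$ such that for every initial condition $a=(a_{\vec n})_{\vec n\in\Omega_{\mathrm D}}$ of real numbers with $a_{\vec n}\ge 0$ for all $\vec n\in\Omega_{\mathrm D}$, $a\not\equiv 0$, $a_{\vec n}=0$ for $\vec n\in\partial\Omega_{\mathrm D}$, and $\max_{\vec n\in\Omega_{\mathrm D}}a_{\vec n}<\varepsilon$, the solution $f^s_{\vec n}$ of the initial-boundary value problem $$f^{s+1}_{\vec n}=\frac{g^s_{\vec n}}{\{1-\alpha\delta (g^s_{\vec n})^\alpha\}^{1/\alpha}}\quad (s\in\mathbb{Z}_{\ge 0},\ \vec n\in\Omega_{\mathrm D}^\circ),\qquad f^0_{\vec n}=a_{\vec n}\quad(\vec n\in\Omega_{\mathrm D}),\qquad f^s_{\vec n}=0\quad (s\in\mathbb{Z}_{\ge0},\ \vec n\in\partial\Omega_{\mathrm D}),$$ where $g^s_{\vec n}:=\frac{1}{2d}\sum_{k=1}^d\left(f^s_{\vec n+\vec e_k}+f^s_{\vec n-\vec e_k}\right)$, does not blow up at any finite time $s_0\in\mathbb{Z}_{\ge 0}$.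
   Context: Here $\vec e_k\in\mathbb{Z}^d$ is the unit vector whose $k$-th component is $1$ and whose other components are $0$. For the box $\Omega_{\mathrm D}$, the boundary $\partial\Omega_{\mathrm D}$ is the set of $\vec n\in\Omega_{\mathrm D}$ with $n_k\in\{0,N_k\}$ for some $k$, and the interior is $\Omega_{\mathrm D}^\circ:=\Omega_{\mathrm D}\setminus\partial\Omega_{\mathrm D}=\{\vec n: 1\le n_k\le N_k-1 \text{ for all } k\}$. The quantity $g^s_{\vec n}$ is considered for $\vec n\in\Omega_{\mathrm D}^\circ$. Blow-up: the solution $f^s_{\vec n}$ is computed recursively in $s$, and the recursion can be continued from time $s$ to time $s+1$ as long as $g^s_{\vec n}<(\alpha\delta)^{-1/\alpha}$ for all $\vec n\in\Omega_{\mathrm D}^\circ$. The solution is said to blow up at time $s_0\in\mathbb{Z}_{\ge0}$ if $g^s_{\vec n}<(\alpha\delta)^{-1/\alpha}$ for all $s<s_0$ and all $\vec n\in\Omega_{\mathrm D}^\circ$, and there exists $\vec n_0\in\Omega_{\mathrm D}^\circ$ with $g^{s_0}_{\vec n_0}\ge(\alpha\delta)^{-1/\alpha}$. Thus ''does not blow up at any finite time'' means that $g^s_{\vec n}<(\alpha\delta)^{-1/\alpha}$ for all $s\in\mathbb{Z}_{\ge 0}$ and $\vec n\in\Omega_{\mathrm D}^\circ$, so that $f^s_{\vec n}$ is defined for all $s$. *)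

(* Defs.v *)
From mathcomp Require Import all_boot all_order all_algebra.
From mathcomp Require Import all_classical all_reals all_analysis.

Set Implicit Arguments.
Unset Strict Implicit.
Unset Printing Implicit Defensive.
Import Order.TTheory GRing.Theory Num.Theory.
Local Open Scope classical_set_scope.
Local Open Scope ring_scope.

Section DirichletBox.
Variables (d : nat) (N : 'I_d -> nat).

Definition box : set 'rV[int]_d :=
  [set n | forall k, 0 <= n 0 k <= (N k)%:Z].

Definition box_boundary : set 'rV[int]_d :=
  [set n | box n /\ exists k, n 0 k = 0 \/ n 0 k = (N k)%:Z].

Definition box_interior : set 'rV[int]_d := box `\` box_boundary.

Lemma box_interiorP (n : 'rV[int]_d) :
  box_interior n <-> forall k, 1 <= n 0 k <= (N k)%:Z - 1.
Proof.
split=> [[nB nbd] k|nI].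
- have /andP[n0 nN] := nB k.
  have neq0 : n 0 k != 0.
    by apply/eqP => e; apply: nbd; split=> //; exists k; left.
  have neqN : n 0 k != (N k)%:Z.
    by apply/eqP => e; apply: nbd; split=> //; exists k; right.
  by rewrite -gtz0_ge1 lt_neqAle eq_sym neq0 n0 /= lerBrDr lezD1 lt_neqAle neqN.
- have nI' k : 0 < n 0 k < (N k)%:Z.
    by have := nI k; rewrite -gtz0_ge1 lerBrDr lezD1.
  split=> [k|[_ [k [] e]]].
  + by have /andP[/ltW -> /ltW ->] := nI' k.
  + by have := nI' k; rewrite e ltxx.
  + by have := nI' k; rewrite e ltxx andbF.
Qed.

End DirichletBox.

Section Problem.
Variables (R : realType) (d : nat) (alpha delta : R) (N : 'I_d -> nat).
Implicit Types (f : nat -> 'rV[int]_d -> R) (a : 'rV[int]_d -> R).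

(* [delta_mx 0 k] is the k-th unit vector. *)
Definition neighbor_mean (u : 'rV[int]_d -> R) (n : 'rV[int]_d) : R :=
  (2 * d)%:R^-1 * \sum_(k < d) (u (n + delta_mx 0 k) + u (n - delta_mx 0 k)).

Definition threshold : R := (alpha * delta) `^ (- alpha^-1).

Definition subcritical f (s : nat) : Prop :=
  forall n, box_interior N n -> neighbor_mean (f s) n < threshold.

Definition step (g : R) : R :=
  g / (1 - alpha * delta * g `^ alpha) `^ (alpha^-1).

(* Grid functions are total, but only their values on [box N] matter: the
   neighbors of an interior point lie in the box.  The recursion is imposed at
   time s only if no blow-up occurred up to time s; past a blow-up the interior
   values of f are unconstrained, i.e. the solution is undefined there. *)
Record is_solution a f : Prop := IsSolution {
  solution_init : forall n, box N n -> f 0%N n = a n ;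
  solution_boundary : forall s n, box_boundary N n -> f s n = 0 ;
  solution_step : forall s, (forall r, (r <= s)%N -> subcritical f r) ->
    forall n, box_interior N n -> f s.+1 n = step (neighbor_mean (f s) n) }.

Definition blows_up_at f (s0 : nat) : Prop :=
  (forall s, (s < s0)%N -> subcritical f s) /\
  exists2 n0, box_interior N n0 & threshold <= neighbor_mean (f s0) n0.

Lemma is_solution_exists a :
  (forall n, box_boundary N n -> a n = 0) -> exists f, is_solution a f.
Proof.
move=> a0; pose F (u : 'rV[int]_d -> R) n :=
  if `[< box_interior N n >] then step (neighbor_mean u n) else 0.
exists (fun s => iter s F a); split=> [//|[|s] n nb|s _ n nI] /=.
- exact: a0.
- by rewrite /F asboolF// => -[].
- by rewrite /F asboolT.
Qed.

End Problem.

(* Main.v *)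
Require Import Defs.
From mathcomp Require Import all_boot all_order all_algebra.
From mathcomp Require Import all_classical all_reals all_analysis.
From mathcomp Require Import zify ring lra.
Import Order.TTheory GRing.Theory Num.Theory.
Local Open Scope ring_scope.

(** The solution stays below a stationary supersolution.  Only one coordinate
    is needed to see the damping due to the Dirichlet condition: the parabola
    p(n) = n_k (N_k - n_k) satisfies mean p = p - 1/d on the interior
    ([neighbor_mean_parabola]), and 0 <= p <= N_k^2, so mean p <= lambda p with
    lambda = 1 - 1/(d N_k^2) < 1.  The nonlinear map g |-> step g amplifies g by
    the factor (1 - alpha delta g^alpha)^(-1/alpha), which tends to 1 as g tends
    to 0; as long as g <= c, where alpha delta c^alpha = 1 - lambda^alpha, this
    factor is at most 1/lambda and cannot undo the contraction by lambda
    ([step_le]).  Hence the bound 0 <= f^s <= eta p with eta = c / N_k^2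
    propagates in time ([supersolution_bound]), and it keeps the neighbor means
    at most c, which is below the blow-up threshold ([lt_threshold]).  Since
    p >= 1 at interior lattice points, the bound holds at time 0 as soon as
    a < eta. *)

(** * Neighbor means on the box *)

Section NeighborMean.
Context {R : realType} {d : nat} {N : 'I_d -> nat}.
Implicit Types (u v : 'rV[int]_d -> R) (n : 'rV[int]_d).

Lemma box_cases {n} : box N n -> box_interior N n \/ box_boundary N n.
Proof. by move=> nB; case: (pselect (box_boundary N n)); [right|left]. Qed.

Lemma box_neighbor {n} k : box_interior N n ->
  box N (n + delta_mx 0 k) /\ box N (n - delta_mx 0 k).
Proof.
move=> /box_interiorP nI.
by split=> j; have := nI j; rewrite !mxE eqxx /=; case: eqP => _ /=; lia.
Qed.

Lemma neighbor_mean_le {u v n} : box_interior N n ->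
  (forall m, box N m -> u m <= v m) -> neighbor_mean u n <= neighbor_mean v n.
Proof.
move=> nI uv; apply: ler_wpM2l; first by rewrite invr_ge0.
by apply: ler_sum => k _; have [? ?] := box_neighbor k nI; apply: lerD; apply: uv.
Qed.

Lemma neighbor_mean_ge0 {u n} : box_interior N n ->
  (forall m, box N m -> 0 <= u m) -> 0 <= neighbor_mean u n.
Proof.
move=> nI u0; apply: mulr_ge0; first by rewrite invr_ge0.
by apply: sumr_ge0 => k _; have [? ?] := box_neighbor k nI; apply: addr_ge0; apply: u0.
Qed.

Lemma neighbor_meanZ (c : R) u n :
  neighbor_mean (fun m => c * u m) n = c * neighbor_mean u n.
Proof.
rewrite /neighbor_mean mulrCA; congr (_ * _).
by rewrite mulr_sumr; apply: eq_bigr => k _; rewrite mulrDr.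
Qed.

End NeighborMean.

(** * The parabola in one coordinate *)

Section Parabola.
Context {R : realType} {d : nat}.
Variables (N : 'I_d -> nat) (k : 'I_d).
Implicit Types n : 'rV[int]_d.

Definition parabola n : R := (n 0 k)%:~R * ((N k)%:R - (n 0 k)%:~R).

(** Only the two neighbors in direction [k] see the parabola bend; its second
    difference is the constant -2. *)
Lemma neighbor_mean_parabola n : neighbor_mean parabola n = parabola n - d%:R^-1.
Proof.
have d0 : d%:R != 0 :> R by rewrite pnatr_eq0; case: d k => [[]|].
have second_difference (j : 'I_d) :
    parabola (n + delta_mx 0 j) + parabola (n - delta_mx 0 j) = 2 * parabola n - 2 * (j == k)%:R.
  rewrite /parabola !mxE eqxx /= [k == j]eq_sym.
  by case: eqP => _ /=; rewrite ?intrD ?intrB ?subr0 ?addr0; ring.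
rewrite /neighbor_mean (eq_bigr _ (fun j _ => second_difference j)) sumrB.
rewrite sumr_const card_ord -mulr_sumr (bigD1 k)//= eqxx big1 => [|j /negPf ->//].
by rewrite natrM addr0 -[2 * _ *+ d]mulr_natr /=; field.
Qed.

Lemma parabola_ge0 {n} : box N n -> 0 <= parabola n.
Proof.
move=> /(_ k) /andP[n0 nN]; apply: mulr_ge0; first by rewrite ler0z.
by rewrite subr_ge0 -[_%:R]/((N k)%:Z%:~R) ler_int.
Qed.

Lemma parabola_le {n} : box N n -> parabola n <= (N k)%:R ^+ 2.
Proof.
move=> /(_ k) /andP[n0 nN]; rewrite /parabola.
have : 0 <= (n 0 k)%:~R :> R by rewrite ler0z.
have : (n 0 k)%:~R <= (N k)%:R :> R by rewrite -[_%:R]/((N k)%:Z%:~R) ler_int.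
by nra.
Qed.

Lemma parabola_ge1 {n} : box_interior N n -> 1 <= parabola n.
Proof.
move=> /box_interiorP /(_ k) /andP[n0 nN]; rewrite /parabola.
have : 1 <= (n 0 k)%:~R :> R by rewrite (ler_int _ 1).
have : (n 0 k)%:~R <= (N k)%:R - 1 :> R.
  by rewrite -[_%:R]/((N k)%:Z%:~R) -(intrB _ _ 1) ler_int.
by nra.
Qed.

(** The constant loss 1/d dominates a fixed proportion of the parabola because
    the latter is bounded by [N k ^ 2]. *)
Lemma neighbor_mean_parabola_le {n} : (0 < N k)%N -> box N n ->
  neighbor_mean parabola n <= (1 - (d * N k ^ 2)%:R^-1) * parabola n.
Proof.
move=> Nk nB; rewrite neighbor_mean_parabola mulrBl mul1r lerD2l lerN2.
rewrite natrM natrX invfM -mulrA ler_piMr ?invr_ge0//.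
by rewrite mulrC ler_pdivrMr ?mul1r ?parabola_le// exprn_gt0 ?ltr0n.
Qed.

End Parabola.

(** * The nonlinear step and supersolutions *)

Section Supersolution.
Context {R : realType} {d : nat} {alpha delta : R} {N : 'I_d -> nat}.
Hypotheses (alpha_gt0 : 0 < alpha) (delta_gt0 : 0 < delta).
Variables lambda c : R.
Hypotheses (lambda_gt0 : 0 < lambda) (c_gt0 : 0 < c).
Hypothesis c_small : alpha * delta * c `^ alpha <= 1 - lambda `^ alpha.

Let ad_gt0 : 0 < alpha * delta. Proof. exact: mulr_gt0. Qed.

(** The threshold is where alpha delta g^alpha reaches 1; the term
    lambda^alpha > 0 keeps c strictly below it. *)
Lemma lt_threshold : c < threshold alpha delta.
Proof.
have cX_lt : c `^ alpha < (alpha * delta)^-1.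
  rewrite -[ltRHS]mul1r ltr_pdivlMr// mulrC (le_lt_trans c_small)//.
  by rewrite ltrBlDr ltrDl powR_gt0.
have -> : c = (c `^ alpha) `^ alpha^-1.
  by rewrite -powRrM mulfV ?gt_eqF// powRr1// ltW.
rewrite /threshold -mulN1r powRrM powR_inv1 ?(ltW ad_gt0)//.
by apply: gt0_ltr_powR; rewrite ?invr_gt0// nnegrE ?powR_ge0// invr_ge0 ltW.
Qed.

(** On [0, c] the amplification factor of [step] is at most 1/lambda. *)
Lemma step_le {g x} : 0 <= g -> g <= c -> g <= lambda * x ->
  0 <= step alpha delta g <= x.
Proof.
move=> g0 gc gx.
have base_ge : lambda `^ alpha <= 1 - alpha * delta * g `^ alpha.
  have : g `^ alpha <= c `^ alpha.
    by apply: ge0_ler_powR; rewrite ?nnegrE ?(ltW alpha_gt0) ?(ltW c_gt0).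
  by move: c_small ad_gt0; nra.
have root_ge : lambda <= (1 - alpha * delta * g `^ alpha) `^ alpha^-1.
  have {1}-> : lambda = (lambda `^ alpha) `^ alpha^-1.
    by rewrite -powRrM mulfV ?gt_eqF// powRr1// ltW.
  apply: ge0_ler_powR => //; rewrite ?nnegrE ?invr_ge0 ?powR_ge0 ?(ltW alpha_gt0)//.
  exact: le_trans (powR_ge0 _ _) base_ge.
have root_gt0 := lt_le_trans lambda_gt0 root_ge.
have x_ge0 : 0 <= x by rewrite -(pmulr_rge0 _ lambda_gt0) (le_trans g0).
rewrite /step divr_ge0 ?powR_ge0//= ler_pdivrMr//.
by rewrite (le_trans gx)// mulrC ler_wpM2l.
Qed.

(** Comparison principle: taking neighbor means preserves f^s <= phi, gains the
    factor lambda because of the inequality satisfied by phi, and [step] gives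
    back at most that factor. *)
Lemma supersolution_bound (phi a : 'rV[int]_d -> R) (f : nat -> 'rV[int]_d -> R) :
  lambda <= 1 ->
  (forall n, box N n -> 0 <= phi n <= c) ->
  (forall n, box_interior N n -> neighbor_mean phi n <= lambda * phi n) ->
  (forall n, box N n -> 0 <= a n <= phi n) ->
  is_solution alpha delta N a f ->
  forall s, subcritical alpha delta N f s.
Proof.
move=> lambda_le1 phi_bnd phi_super a_bnd [f_init f_bd f_step].
have mean_bnd s n : (forall m, box N m -> 0 <= f s m <= phi m) ->
    box_interior N n ->
    [/\ 0 <= neighbor_mean (f s) n, neighbor_mean (f s) n <= c
      & neighbor_mean (f s) n <= lambda * phi n].
  move=> fs nI.
  have g0 : 0 <= neighbor_mean (f s) n.
    by apply: (neighbor_mean_ge0 nI) => m /fs /andP[].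
  have g_super : neighbor_mean (f s) n <= lambda * phi n.
    apply: le_trans (phi_super n nI).
    by apply: (neighbor_mean_le nI) => m /fs /andP[].
  have /andP[phi0 phic] := phi_bnd n nI.1.
  by split=> //; apply: le_trans phic; apply: le_trans g_super _; rewrite ler_piMl.
have sub s : (forall m, box N m -> 0 <= f s m <= phi m) ->
    subcritical alpha delta N f s.
  by move=> fs n nI; have [_ gc _] := mean_bnd s n fs nI; apply: le_lt_trans lt_threshold.
(* Subcriticality at all earlier times is carried along, since the recursion
   is only granted up to the first blow-up. *)
suff bnd s : (forall m, box N m -> 0 <= f s m <= phi m) /\
    forall r, (r <= s)%N -> subcritical alpha delta N f r.
  by move=> s; apply: (bnd s).2.
elim: s => [|s [fs subs]].
  have f0 m : box N m -> 0 <= f 0%N m <= phi m.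
    by move=> mB; rewrite f_init ?a_bnd.
  by split=> // r; rewrite leqn0 => /eqP ->; apply: sub.
have fs1 m : box N m -> 0 <= f s.+1 m <= phi m.
  move=> mB; have [mI|mbd] := box_cases mB.
    by rewrite f_step//; have [? ? ?] := mean_bnd s m fs mI; apply: step_le.
  by rewrite f_bd// lexx; case/andP: (phi_bnd m mB).
by split=> // r; rewrite leq_eqVlt ltnS => /orP[/eqP ->|/subs//]; apply: sub.
Qed.

End Supersolution.

Theorem theorem2 (R : realType) (d : nat) (hd : (1 <= d)%N)
  (alpha delta : R) (halpha : 0 < alpha) (hdelta : 0 < delta)
  (N : 'I_d -> nat) (hN : forall k, (2 <= N k)%N) :
  exists2 eps : R, 0 < eps &
    forall a : 'rV[int]_d -> R,
      (forall n, box N n -> 0 <= a n) ->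
      (exists2 n, box N n & a n != 0) ->
      (forall n, box_boundary N n -> a n = 0) ->
      (forall n, box N n -> a n < eps) ->
      forall f : nat -> 'rV[int]_d -> R,
        is_solution alpha delta N a f ->
        forall s0 : nat, ~ blows_up_at alpha delta N f s0.
Proof.
pose k : 'I_d := Ordinal hd.
have Nk : (0 < N k)%N by apply: leq_trans (hN k).
have M_gt0 : 0 < (N k)%:R ^+ 2 :> R by rewrite exprn_gt0 ?ltr0n.
pose lambda : R := 1 - (d * N k ^ 2)%:R^-1.
have dM : (1 < d * N k ^ 2)%N by have := hN k; nia.
have lambda_gt0 : 0 < lambda by rewrite subr_gt0 invf_lt1 ?ltr1n ?ltr0n// ltnW.
have lambda_lt1 : lambda < 1 by rewrite ltrBlDr ltrDl invr_gt0 ltr0n ltnW.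
have ad_gt0 : 0 < alpha * delta by exact: mulr_gt0.
have lambdaX_lt1 : lambda `^ alpha < 1.
  have -> : 1 = 1 `^ alpha :> R by rewrite powR1.
  by apply: gt0_ltr_powR; rewrite ?nnegrE ?(ltW lambda_gt0).
(* The largest size at which [step] amplifies by at most 1/lambda. *)
pose c := ((1 - lambda `^ alpha) / (alpha * delta)) `^ alpha^-1.
have c_gt0 : 0 < c by rewrite powR_gt0// divr_gt0// subr_gt0.
have c_small : alpha * delta * c `^ alpha <= 1 - lambda `^ alpha.
  rewrite /c -powRrM mulVf ?gt_eqF// powRr1; first by rewrite mulrC divfK ?gt_eqF.
  by rewrite ltW// divr_gt0// subr_gt0.
pose eta := c / (N k)%:R ^+ 2.
have eta_gt0 : 0 < eta by rewrite divr_gt0.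
exists eta => // a a_ge0 _ a_bd a_lt f f_sol s0 [_ [n nI]].
apply/negP; rewrite -ltNge.
apply: (@supersolution_bound _ _ _ _ N halpha hdelta lambda c lambda_gt0 c_gt0
  c_small (fun n => eta * parabola N k n) a f) => //.
- exact: ltW.
- move=> m mB; rewrite mulr_ge0 ?parabola_ge0 ?(ltW eta_gt0)//=.
  rewrite /eta -mulrA ler_piMr ?(ltW c_gt0)// mulrC.
  by rewrite ler_pdivrMr// mul1r parabola_le.
- move=> m mI; rewrite neighbor_meanZ [leRHS]mulrCA ler_pM2l//.
  exact: neighbor_mean_parabola_le Nk mI.1.
- move=> m mB; rewrite a_ge0//=; have [mI|mbd] := box_cases mB.
    by apply: le_trans (ltW (a_lt m mB)) _; rewrite ler_peMr ?parabola_ge1 ?ltW.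
  by rewrite a_bd// mulr_ge0 ?parabola_ge0 ?ltW.
Qed.
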